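(* If $L\subseteq\omega$ is $\Delta^0_2$ and $1$-generic, then $L$ is index guessable.
   Context: $(\Phi_e)_{e\in\omega}$ is a standard effective list of the Turing functionals with one input, and $\varphi_e=\Phi_e^{\emptyset}$. An oracle $L$ is index guessable if there is a Turing functional $\Gamma$ such that for each $e$, if $\Phi_e^L$ is a (total) computable function, then $\Gamma(\emptyset';e)$ is defined and $\Phi_e^L=\varphi_{\Gamma(\emptyset';e)}$. No assumption is made on the convergence of $\Gamma(\emptyset';e)$ in case $\Phi_e^L$ is not a computable function. A set $L$ is $1$-generic if for each c.e. set $S$ of finite binary strings, there is $k$ such that either the initial segment $L\upharpoonright k$ is in $S$, or no string extending $L\upharpoonright k$ is in $S$. *)

(* Defs.v *)
From Stdlib Require Cantor.
From mathcomp Require Import all_boot.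
From mathcomp Require Import boolp classical_sets.

Set Implicit Arguments.
Unset Strict Implicit.
Unset Printing Implicit Defensive.

Local Open Scope classical_set_scope.

(* Turing functionals are presented as the partial recursive functionals with
   an oracle.  All functions are unary; several arguments are passed through
   the Cantor pairing bijection. *)

Definition npair (x y : nat) : nat := Cantor.to_nat (x, y).
Definition nfst (z : nat) : nat := (Cantor.of_nat z).1.
Definition nsnd (z : nat) : nat := (Cantor.of_nat z).2.

Inductive code : Type :=
| Zero | Succ | Fst | Snd | Oracle
| Pair of code & code
| Comp of code & code
| Rec of code & code
| Mu of code.

(* [eval X c x y] means that the computation of [c] with oracle [X] on input
   [x] converges with output [y].
   - [Rec f g] is primitive recursion: h<a, 0> = f a and
     h<a, n + 1> = g<a, <n, h<a, n>>>.
   - [Mu f] maps x to the least n such that f<x, n> = 0, provided that f<x, i>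
     converges for all i < n. *)
Fixpoint eval (X : set nat) (c : code) : nat -> nat -> Prop :=
  match c with
  | Zero => fun _ y => y = 0
  | Succ => fun x y => y = x.+1
  | Fst => fun x y => y = nfst x
  | Snd => fun x y => y = nsnd x
  | Oracle => fun x y => y = (x \in X) :> nat
  | Pair f g => fun x z =>
      exists a b, [/\ eval X f x a, eval X g x b & z = npair a b]
  | Comp f g => fun x z => exists2 y, eval X g x y & eval X f y z
  | Rec f g => fun x =>
      iteri (nsnd x)
        (fun n (h : nat -> Prop) z =>
           exists2 y, h y & eval X g (npair (nfst x) (npair n y)) z)
        (eval X f (nfst x))
  | Mu f => fun x n =>
      eval X f (npair x n) 0 /\
      forall i, i < n -> exists y, eval X f (npair x i) y.+1
  end.

(* A bijective Goedel numbering of the codes (see [encode_bij]). *)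
Fixpoint encode (c : code) : nat :=
  match c with
  | Zero => 0
  | Succ => 1
  | Fst => 2
  | Snd => 3
  | Oracle => 4
  | Pair f g => 5 + 4 * npair (encode f) (encode g)
  | Comp f g => 6 + 4 * npair (encode f) (encode g)
  | Rec f g => 7 + 4 * npair (encode f) (encode g)
  | Mu f => 8 + 4 * encode f
  end.

(* [Phi X e x y] is Phi_e^X(x) = y; partial functions are identified with their
   graphs. *)
Definition Phi (X : set nat) (e : nat) (x y : nat) : Prop :=
  exists2 c, encode c = e & eval X c x y.

Definition phi (e : nat) : nat -> nat -> Prop := Phi set0 e.

Definition total_computable (F : nat -> nat -> Prop) : Prop :=
  (forall x, exists y, F x y) /\ exists i, F = phi i.

Definition computable_set (A : set nat) : Prop :=
  exists i, forall x, phi i x (x \in A).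

Definition ce_set (A : set nat) : Prop :=
  exists i, A = [set x | exists y, phi i x y].

Definition halting_set : set nat := [set e | exists y, phi e e y].

Definition index_guessable (L : set nat) : Prop :=
  exists g, forall e, total_computable (Phi L e) ->
    exists2 i, Phi halting_set g e i & Phi L e = phi i.

Definition sigma02 (A : set nat) : Prop :=
  exists2 R, computable_set R &
    A = [set x | exists y, forall z, R (npair x (npair y z))].

Definition pi02 (A : set nat) : Prop :=
  exists2 R, computable_set R &
    A = [set x | forall y, exists z, R (npair x (npair y z))].

Definition delta02 (A : set nat) : Prop := sigma02 A /\ pi02 A.

(* Bijective base-2 numeration, so that each number codes exactly one string. *)
Definition string_code (s : seq bool) : nat :=
  foldr (fun (b : bool) n => n.*2 + b.+1) 0 s.

Definition ce_strings (S : set (seq bool)) : Prop := ce_set (string_code @` S).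

Definition restrict (L : set nat) (k : nat) : seq bool :=
  mkseq (fun i => i \in L) k.

Definition one_generic (L : set nat) : Prop :=
  forall S : set (seq bool), ce_strings S ->
    exists k, S (restrict L k) \/
      forall t, prefix (restrict L k) t -> ~ S t.

Lemma npairK x y : nfst (npair x y) = x /\ nsnd (npair x y) = y.
Proof. by rewrite /nfst /nsnd /npair Cantor.cancel_of_to. Qed.

Lemma nfst_nsndK z : npair (nfst z) (nsnd z) = z.
Proof. by rewrite /npair /nfst /nsnd -surjective_pairing Cantor.cancel_to_of. Qed.

Lemma npair_inj x y x' y' : npair x y = npair x' y' -> x = x' /\ y = y'.
Proof.
move=> e; have [e1 e2] := npairK x y; have [e3 e4] := npairK x' y'.
by split; [rewrite -e1 e e3 | rewrite -e2 e e4].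
Qed.

Lemma npair_ge z : nfst z <= z /\ nsnd z <= z.
Proof.
rewrite -{2 4}(nfst_nsndK z) /npair.
have /leP := Cantor.to_nat_non_decreasing (nfst z) (nsnd z).
by move=> le; split; apply: leq_trans le; rewrite ?leq_addl ?leq_addr.
Qed.

Lemma encode_bij : bijective encode.
Proof.
have inj : injective encode.
  have key r r' m m' : r < 4 -> r' < 4 -> r + 4 * m = r' + 4 * m' ->
      r = r' /\ m = m'.
    move=> lr lr' e; have er : r = r'.
      by rewrite -(modn_small lr) -(modn_small lr') -(modnMDl m r 4)
        -(modnMDl m' r' 4) ![_ * 4 + _]addnC ![_ * 4]mulnC e.
    split=> //; move: e; rewrite er => /addnI/eqP.
    by rewrite eqn_pmul2l // => /eqP.
  elim=> [|||||f IHf g IHg|f IHf g IHg|f IHf g IHg|f IHf]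
    [|||||f' g'|f' g'|f' g'|f'] //=;
    rewrite -1?[6 + _]/(5 + (1 + _)) -1?[7 + _]/(5 + (2 + _))
      -1?[8 + _]/(5 + (3 + _)) => /(@addnI 5) e;
    try first [ by case: (key 0 1 _ _ isT isT e) | by case: (key 0 2 _ _ isT isT e)
              | by case: (key 0 3 _ _ isT isT e) | by case: (key 1 0 _ _ isT isT e)
              | by case: (key 1 2 _ _ isT isT e) | by case: (key 1 3 _ _ isT isT e)
              | by case: (key 2 0 _ _ isT isT e) | by case: (key 2 1 _ _ isT isT e)
              | by case: (key 2 3 _ _ isT isT e) | by case: (key 3 0 _ _ isT isT e)
              | by case: (key 3 1 _ _ isT isT e) | by case: (key 3 2 _ _ isT isT e)].
  - by have [//|//|_ /npair_inj[/IHf-> /IHg->]] := key 0 0 _ _ _ _ e.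
  - by have [//|//|_ /npair_inj[/IHf-> /IHg->]] := key 1 1 _ _ _ _ e.
  - by have [//|//|_ /npair_inj[/IHf-> /IHg->]] := key 2 2 _ _ _ _ e.
  - by have [//|//|_ /IHf->] := key 3 3 _ _ _ _ e.
have surj e : exists c, encode c = e.
  elim/ltn_ind: e => -[|[|[|[|[|e]]]]] IH;
    [by exists Zero|by exists Succ|by exists Fst|by exists Snd|by exists Oracle|].
  have lt m : m <= e %/ 4 -> m < e.+1.+4.
    by move=> /leq_trans/(_ (leq_div e 4)) le; rewrite ltnS; do 4 apply: leqW.
  have [l1 l2] := npair_ge (e %/ 4).
  have [f ef] := IH _ (lt _ l1); have [g eg] := IH _ (lt _ l2).
  have [h eh] := IH _ (lt _ (leqnn _)).
  have lr : e %% 4 < 4 by rewrite ltn_mod.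
  have de := divn_eq e 4; rewrite mulnC addnC in de.
  case: (e %% 4) lr de => [|[|[|[|//]]]] _ de; rewrite [in e.+1.+4]de.
  - by exists (Pair f g); rewrite /= ef eg nfst_nsndK.
  - by exists (Comp f g); rewrite /= ef eg nfst_nsndK.
  - by exists (Rec f g); rewrite /= ef eg nfst_nsndK.
  - by exists (Mu h); rewrite /= eh.
have [d dK] := choice surj.
by exists d => // c; apply: inj.
Qed.

Lemma eval_functional X c x y y' : eval X c x y -> eval X c x y' -> y = y'.
Proof.
elim: c x y y' => [|||||f IHf g IHg|f IHf g IHg|f IHf g IHg|f IHf] x y y' /=;
  try by move=> -> ->.
- move=> [a [b [fa gb ->]]] [a' [b' [fa' gb' ->]]].
  by rewrite (IHf _ _ _ fa fa') (IHg _ _ _ gb gb').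
- by move=> [a ga fa] [a' ga']; rewrite -(IHg _ _ _ ga ga'); apply: IHf.
- elim: (nsnd x) y y' => [|n IHn] y y' /=; first exact: IHf.
  by move=> [a ha ga] [a' ha']; rewrite -(IHn _ _ ha ha'); apply: IHg.
- move=> [f0 lt] [f0' lt']; have [yy'|y'y|//] := ltngtP y y'.
  + by have [z /(IHf _ _ _ f0)] := lt' _ yy'.
  + by have [z /(IHf _ _ _ f0')] := lt _ y'y.
Qed.

Lemma Phi_functional X e x y y' : Phi X e x y -> Phi X e x y' -> y = y'.
Proof.
by move=> [c <- cy] [c' /(bij_inj encode_bij)->]; apply: eval_functional cy.
Qed.

Lemma string_code_inj : injective string_code.
Proof.
elim=> [|b s IHs] [|b' s'] //=; rewrite ?addnS //.
move=> [e]; have eb : b = b'.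
  by move: (congr1 odd e); rewrite !oddD !odd_double /= !oddb.
by move: e; rewrite eb => /addIn/double_inj/IHs->.
Qed.

(* Main.v *)
Require Import Defs.
From mathcomp Require Import all_boot boolp classical_sets.

(** Suppose that Phi_e^L is total and computable, say equal to [f].  The strings
    along which Phi_e converges on some [x] to a value other than [f x] form a
    c.e. set.  No initial segment of L belongs to it, because a computation that
    converges along an initial segment of L is a computation with oracle L.  As
    L is 1-generic, some [k] is such that no extension of L|k belongs to it
    ([generic_decides]), so all computations of Phi_e along extensions of L|k
    that converge on the same input give the same value: Phi_e does not split
    above L|k.

    Conversely, let [k] be any number such that Phi_e does not split above L|k.
    Then Phi_e^L is computed without oracle as follows: on input [x], search for
    an extension of L|k along which Phi_e converges on [x], and return the value
    ([amalgam]).  The search succeeds since long initial segments of L are such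
    extensions ([run_position]), and for the same reason the value found is that
    of Phi_e^L, as there is no splitting.

    Given [e], the halting set finds such a [k]: it computes L, because L is
    Delta^0_2 ([delta02_computable]), and it decides whether Phi_e splits above
    a given string, because this is an existential question
    ([halting_splits]).  From [e], [k] and L|k an index for the amalgamated
    function is then computed.

    All this must be uniform in [e].  Instead of a universal functional, the
    proof translates each code [c] into a code [bounded c] that takes an oracle
    string and a bound as additional inputs, cuts every search at the bound, and
    thus always converges.  The translation follows the structure of codes, so
    on Goedel numbers it is a course-of-values recursion
    ([computable_encode_bounded]); the questions to the halting set and the
    final index are fixed codes composed with [bounded c]. *)

Set Implicit Arguments.
Unset Strict Implicit.
Unset Printing Implicit Defensive.

Local Open Scope classical_set_scope.

(** * Closure properties of the functions computable in an oracle *)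

Definition computable_in (X : set nat) (f : nat -> nat) : Prop :=
  exists c, forall x, eval X c x (f x).

Lemma npairE x y : (nfst (npair x y) = x) * (nsnd (npair x y) = y).
Proof. by have [-> ->] := npairK x y. Qed.

Lemma eval_Pair X f g x y z :
  eval X f x y -> eval X g x z -> eval X (Pair f g) x (npair y z).
Proof. by exists y, z. Qed.

Lemma eval_Comp X f g x y z :
  eval X g x y -> eval X f y z -> eval X (Comp f g) x z.
Proof. by exists y. Qed.

Lemma eval_Rec X f g x y n (G : nat -> nat -> nat) :
  eval X f x y -> (forall i h, eval X g (npair x (npair i h)) (G i h)) ->
  eval X (Rec f g) (npair x n) (iteri n G y).
Proof.
move=> fx gx /=; rewrite !npairE; elim: n => //= n IHn.
by exists (iteri n G y).
Qed.

Create HintDb computable.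
#[local] Ltac computability := auto 40 with computable.

Lemma eq_computable X f g :
  f =1 g -> computable_in X f -> computable_in X g.
Proof. by move=> /funext->. Qed.

Implicit Types (X : set nat) (f g : nat -> nat).

Lemma computable_id X : computable_in X (fun x => x).
Proof.
exists (Pair Fst Snd) => x /=; exists (nfst x), (nsnd x).
by rewrite nfst_nsndK.
Qed.

Lemma computable_comp X f g :
  computable_in X f -> computable_in X g -> computable_in X (fun x => f (g x)).
Proof. by move=> [c cf] [d dg]; exists (Comp c d) => x /=; exists (g x). Qed.

Lemma computable_cst X k : computable_in X (fun=> k).
Proof.
elim: k => [|k [c ck]]; first by exists Zero.
by exists (Comp Succ c) => x /=; exists k.
Qed.

Lemma computable_S X f :
  computable_in X f -> computable_in X (fun x => (f x).+1).
Proof. by apply: (@computable_comp X S); exists Succ. Qed.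

Lemma computable_fst X f :
  computable_in X f -> computable_in X (fun x => nfst (f x)).
Proof. by apply: (@computable_comp X nfst); exists Fst. Qed.

Lemma computable_snd X f :
  computable_in X f -> computable_in X (fun x => nsnd (f x)).
Proof. by apply: (@computable_comp X nsnd); exists Snd. Qed.

Lemma computable_oracle X f :
  computable_in X f -> computable_in X (fun x => f x \in X).
Proof. by apply: (@computable_comp X (fun x => x \in X)); exists Oracle. Qed.

Lemma computable_pair X f g :
  computable_in X f -> computable_in X g ->
  computable_in X (fun x => npair (f x) (g x)).
Proof.
by move=> [c cf] [d dg]; exists (Pair c d) => x /=; exists (f x), (g x).
Qed.

Lemma computable_iteri X (n f : nat -> nat) (G : nat -> nat -> nat -> nat) :
  computable_in X n -> computable_in X f ->
  computable_in X (fun z => G (nfst z) (nfst (nsnd z)) (nsnd (nsnd z))) ->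
  computable_in X (fun x => iteri (n x) (G x) (f x)).
Proof.
move=> cn [c cf] [d dG].
pose it z := iteri (nsnd z) (G (nfst z)) (f (nfst z)).
suff cit : computable_in X it.
  have -> : (fun x => iteri (n x) (G x) (f x)) = (fun x => it (npair x (n x))).
    by apply/funext => x; rewrite /it !npairE.
  apply: computable_comp cit _.
  by apply: computable_pair => //; apply: computable_id.
exists (Rec c d) => z; rewrite -[X in eval _ _ X](nfst_nsndK z).
apply: eval_Rec => // i h.
by have := dG (npair (nfst z) (npair i h)); rewrite !npairE.
Qed.

Lemma computable_iter X (n f : nat -> nat) (G : nat -> nat -> nat) :
  computable_in X n -> computable_in X f ->
  computable_in X (fun z => G (nfst z) (nsnd z)) ->
  computable_in X (fun x => iter (n x) (G x) (f x)).
Proof.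
move=> cn cf cG.
have -> : (fun x => iter (n x) (G x) (f x)) =
          (fun x => iteri (n x) (fun _ => G x) (f x)).
  by apply/funext => x; elim: (n x) => //= m ->.
apply: computable_iteri => //.
have cz : computable_in X (fun z => npair (nfst z) (nsnd (nsnd z))).
  by do !(apply: computable_pair || apply: computable_fst ||
          apply: computable_snd || apply: computable_id).
by apply: eq_computable (computable_comp cG cz) => z; rewrite !npairE.
Qed.

#[local] Hint Resolve computable_id computable_cst computable_S : computable.
#[local] Hint Resolve computable_fst computable_snd computable_pair : computable.
#[local] Hint Resolve computable_oracle : computable.
#[local] Hint Resolve computable_iteri computable_iter : computable.

(* A function known to be computable by hypothesis is handled as the outer
   function of a composition. *)
#[local] Hint Extern 3 (computable_in _ _) =>
  match goal with H : computable_in _ _ |- _ =>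
    refine (computable_comp H _) end : computable.

Lemma computable_add X f g :
  computable_in X f -> computable_in X g -> computable_in X (fun x => f x + g x).
Proof.
move=> cf cg; apply: (@eq_computable X (fun x => iter (g x) S (f x))).
  by move=> x; rewrite iter_succn.
by computability.
Qed.

Lemma computable_pred X f :
  computable_in X f -> computable_in X (fun x => (f x).-1).
Proof.
move=> cf; apply: (@eq_computable X (fun x => iteri (f x) (fun i _ => i) 0)).
  by move=> x; case: (f x).
by computability.
Qed.
#[local] Hint Resolve computable_add computable_pred : computable.

Lemma computable_sub X f g :
  computable_in X f -> computable_in X g -> computable_in X (fun x => f x - g x).
Proof.
move=> cf cg; apply: (@eq_computable X (fun x => iter (g x) predn (f x))).
  by move=> x; rewrite iter_predn.
by computability.
Qed.

Lemma computable_mul X f g :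
  computable_in X f -> computable_in X g -> computable_in X (fun x => f x * g x).
Proof.
move=> cf cg; apply: (@eq_computable X (fun x => iter (g x) (addn (f x)) 0)).
  by move=> x; rewrite iter_addn_0.
by computability.
Qed.
#[local] Hint Resolve computable_sub computable_mul : computable.

Lemma computable_expn X f g :
  computable_in X f -> computable_in X g -> computable_in X (fun x => f x ^ g x).
Proof.
move=> cf cg; apply: (@eq_computable X (fun x => iter (g x) (muln (f x)) 1)).
  by move=> x; rewrite iter_muln_1.
by computability.
Qed.

Lemma computable_negb X (b : nat -> bool) :
  computable_in X b -> computable_in X (fun x => ~~ b x).
Proof.
move=> cb; apply: (@eq_computable X (fun x => 1 - b x)).
  by move=> x; case: (b x).
by computability.
Qed.

Lemma computable_andb X (a b : nat -> bool) :
  computable_in X a -> computable_in X b -> computable_in X (fun x => a x && b x).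
Proof.
move=> ca cb; apply: (@eq_computable X (fun x => a x * b x)).
  by move=> x; rewrite mulnb.
by computability.
Qed.
#[local] Hint Resolve computable_expn computable_negb : computable.
#[local] Hint Resolve computable_andb : computable.

Lemma computable_if X (b : nat -> bool) f g :
  computable_in X b -> computable_in X f -> computable_in X g ->
  computable_in X (fun x => if b x then f x else g x).
Proof.
move=> cb cf cg.
apply: (@eq_computable X (fun x => b x * f x + (1 - b x) * g x)).
  by move=> x; case: (b x); rewrite ?mul1n ?mul0n ?addn0.
by computability.
Qed.

Lemma computable_leq X f g :
  computable_in X f -> computable_in X g -> computable_in X (fun x => f x <= g x).
Proof.
move=> cf cg; apply: (@eq_computable X (fun x => 1 - (f x - g x))).
  by move=> x; rewrite /leq; case: (f x - g x).
by computability.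
Qed.
#[local] Hint Resolve computable_if computable_leq : computable.

Lemma computable_eqn X f g :
  computable_in X f -> computable_in X g -> computable_in X (fun x => f x == g x).
Proof.
move=> cf cg; apply: (@eq_computable X (fun x => (f x <= g x) && (g x <= f x))).
  by move=> x; rewrite -eqn_leq.
by computability.
Qed.

Lemma computable_odd X f :
  computable_in X f -> computable_in X (fun x => odd (f x)).
Proof.
move=> cf; apply: (@eq_computable X (fun x => iter (f x) (fun y => 1 - y) 0)).
  by move=> x; elim: (f x) => //= n ->; case: odd.
by computability.
Qed.
#[local] Hint Resolve computable_eqn computable_odd : computable.

Lemma computable_half X f :
  computable_in X f -> computable_in X (fun x => (f x)./2).
Proof.
move=> cf.
apply: (@eq_computable X (fun x => iteri (f x) (fun i y => odd i + y) 0)).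
  by move=> x; elim: (f x) => //= n ->; rewrite uphalf_half.
by computability.
Qed.

#[local] Hint Resolve computable_half : computable.

Lemma computable_divn4 X f :
  computable_in X f -> computable_in X (fun x => f x %/ 4).
Proof.
move=> cf; apply: (@eq_computable X (fun x => (f x)./2./2)).
  by move=> x; rewrite -!divn2 -divnMA.
by computability.
Qed.
#[local] Hint Resolve computable_divn4 : computable.

Lemma computable_modn4 X f :
  computable_in X f -> computable_in X (fun x => f x %% 4).
Proof.
move=> cf; apply: (@eq_computable X (fun x => f x - f x %/ 4 * 4)).
  by move=> x; rewrite {1}(divn_eq (f x) 4) addKn.
by computability.
Qed.
#[local] Hint Resolve computable_modn4 : computable.

Lemma eval_Mu X c f x : (forall z, eval X c z (f z)) ->
  (exists n, f (npair x n) = 0) ->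
  exists2 n, eval X (Mu c) x n & f (npair x n) = 0.
Proof.
move=> cf [m fm0]; have ex : exists n, f (npair x n) == 0 by exists m; apply/eqP.
case: (ex_minnP ex) => n /eqP fn0 nmin; exists n => //; split.
  by rewrite -fn0.
move=> i ltin; exists (f (npair x i)).-1.
rewrite prednK // lt0n; apply/negP => /nmin.
by rewrite leqNgt ltin.
Qed.

Lemma computable_search X f : computable_in X f ->
  (forall x, exists n, f (npair x n) = 0) ->
  exists2 g, computable_in X g & forall x, f (npair x (g x)) = 0.
Proof.
move=> [c cf] ex.
have /choice[g gP] : forall x, exists n, eval X (Mu c) x n /\ f (npair x n) = 0.
  by move=> x; have [n] := eval_Mu cf (ex x); exists n.
by exists g => [|x]; [exists (Mu c) => x|]; case: (gP x).
Qed.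

(** The table of the values of [t] below [n] is the iterated pair
    <t (n - 1), <t (n - 2), ... <t 0, 0>>>, so that adding a value is one
    pairing; the value at [i] lies below n - i - 1 second projections. *)
Definition history (t : nat -> nat) (n : nat) : nat :=
  iteri n (fun i h => npair (t i) h) 0.

Definition recall (n h i : nat) : nat := nfst (iter (n - i.+1) nsnd h).

Lemma recallE t n i : i < n -> recall n (history t n) i = t i.
Proof.
rewrite /recall; elim: n => // n IHn; rewrite ltnS leq_eqVlt subSS.
case/predU1P => [->|ltin]; first by rewrite subnn /= npairE.
by rewrite -[n - i]prednK ?subn_gt0 // iterSr /= npairE -subnS IHn.
Qed.

Lemma computable_recall X n h i :
  computable_in X n -> computable_in X h -> computable_in X i ->
  computable_in X (fun x => recall (n x) (h x) (i x)).
Proof. by move=> cn ch ci; rewrite /recall; computability. Qed.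
#[local] Hint Resolve computable_recall : computable.

Lemma computable_course_of_values X t (G : nat -> nat -> nat) :
  computable_in X (fun z => G (nfst z) (nsnd z)) ->
  (forall n, t n = G n (history t n)) -> computable_in X t.
Proof.
move=> cG tE; have ch : computable_in X (history t).
  apply: (@eq_computable X
    (fun n => iteri n (fun i h => npair (G i h) h) 0)).
    by elim=> //= n ->; rewrite -tE.
  have cG' : computable_in X (fun z => G (nfst (nsnd z)) (nsnd (nsnd z))).
    by apply: (computable_comp cG); computability.
  by computability.
apply: (@eq_computable X (fun n => nfst (history t n.+1))).
  by move=> n; rewrite /= npairE.
by computability.
Qed.

(** * Codes as data *)

(** A choice of code turns a computable function into a term that can be placed
    inside other codes, and whose Goedel number is a constant. *)
Definition code_of (f : nat -> nat) : code :=
  if pselect (computable_in set0 f) is left cf then projT1 (cid cf) else Zero.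

Lemma code_ofP f :
  computable_in set0 f -> forall x, eval set0 (code_of f) x (f x).
Proof. by rewrite /code_of => cf; case: pselect => // cf'; case: cid. Qed.

Fixpoint const_code (n : nat) : code :=
  if n is m.+1 then Comp Succ (const_code m) else Zero.

Lemma eval_const_code X n x : eval X (const_code n) x n.
Proof. by elim: n => //= n IHn; exists n. Qed.

(** Goedel numbers of compound codes in terms of those of the parts: they make a
    translation of codes into an arithmetic function. *)
Definition ePair m n := 5 + 4 * npair m n.
Definition eComp m n := 6 + 4 * npair m n.
Definition eRec m n := 7 + 4 * npair m n.
Definition eMu m := 8 + 4 * m.

Section Encode.
Variables (X : set nat) (f g : nat -> nat).
Hypotheses (cf : computable_in X f) (cg : computable_in X g).

Lemma computable_ePair : computable_in X (fun x => ePair (f x) (g x)).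
Proof. by rewrite /ePair; computability. Qed.

Lemma computable_eComp : computable_in X (fun x => eComp (f x) (g x)).
Proof. by rewrite /eComp; computability. Qed.

Lemma computable_eRec : computable_in X (fun x => eRec (f x) (g x)).
Proof. by rewrite /eRec; computability. Qed.

Lemma computable_eMu : computable_in X (fun x => eMu (f x)).
Proof. by rewrite /eMu; computability. Qed.

End Encode.
#[local] Hint Resolve computable_ePair computable_eComp : computable.
#[local] Hint Resolve computable_eRec computable_eMu : computable.

Lemma computable_encode_const_code X f :
  computable_in X f -> computable_in X (fun x => encode (const_code (f x))).
Proof.
move=> cf; apply: (@eq_computable X (fun x => iter (f x) (eComp 1) 0)).
  by move=> x; elim: (f x) => //= n ->.
by computability.
Qed.
#[local] Hint Resolve computable_encode_const_code : computable.

(** * Questions to the halting set *)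

Definition search_from (c : code) (p : nat) : code := Comp (Mu c) (const_code p).

(** The input of [search_from c p] is ignored, so whether the code halts on its
    own number only depends on the outcome of the search. *)
Lemma halting_search_from c f p : (forall x, eval set0 c x (f x)) ->
  (encode (search_from c p) \in halting_set) <-> (exists z, f (npair p z) = 0).
Proof.
move=> cf; rewrite in_setE; split.
  move=> [y [d /(bij_inj encode_bij)->]] /= [q].
  move=> /(eval_functional (eval_const_code set0 p _))<- [cy _].
  by exists y; apply: eval_functional cy.
move=> /(eval_Mu cf)[y cy _]; exists y, (search_from c p) => //=.
by exists p => //; apply: eval_const_code.
Qed.

Lemma computable_encode_search_from X c :
  computable_in X (fun p => encode (search_from c p)).
Proof.
have -> : (fun p => encode (search_from c p)) =
   (fun p => eComp (encode (Mu c)) (encode (const_code p))) by [].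
by computability.
Qed.

Lemma computable_set_characteristic A :
  computable_set A -> computable_in set0 (fun x => x \in A).
Proof.
move=> [i Ai].
have [d ed] : exists d, encode d = i by case: (Ai 0) => d; exists d.
by exists d => x; case: (Ai x) => d'; rewrite -ed => /(bij_inj encode_bij)->.
Qed.

(** For fixed [y], whether [R] holds of <x, <y, z>> for all [z], and whether
    [R'] fails of it for all [z], are questions to the halting set.  A [y] for
    which one of the two answers is positive exists in any case, and it tells
    whether [x] belongs to [A]. *)
Lemma delta02_computable A :
  delta02 A -> computable_in halting_set (fun x => x \in A).
Proof.
move=> [[R /computable_set_characteristic cR AR]].
move=> [R' /computable_set_characteristic cR' AR'].
pose r w := npair (nfst (nfst w)) (npair (nsnd (nfst w)) (nsnd w)).
have rE x y z : r (npair (npair x y) z) = npair x (npair y z).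
  by rewrite /r !npairE.
have [c cP] : computable_in set0 (fun w => r w \in R).
  by apply: (computable_comp cR); rewrite /r; computability.
have [c' cP'] : computable_in set0 (fun w => r w \notin R').
  apply: (@computable_comp set0 (fun v => v \notin R')); first by computability.
  by rewrite /r; computability.
pose q p : bool := encode (search_from c p) \in halting_set.
pose q' p : bool := encode (search_from c' p) \in halting_set.
have qP x y : q (npair x y) <-> exists z, ~ R (npair x (npair y z)).
  rewrite /q (halting_search_from _ cP); split=> -[z].
    by rewrite rE => e; exists z => Rz; move: e; rewrite mem_set.
  by move=> nR; exists z; rewrite rE memNset.
have qP' x y : q' (npair x y) <-> exists z, R' (npair x (npair y z)).
  rewrite /q' (halting_search_from _ cP'); split=> -[z].
    by rewrite rE => e; exists z; apply: contrapT => nR; move: e; rewrite memNset.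
  by move=> Rz; exists z; rewrite rE mem_set.
have cq : computable_in halting_set (fun p => q p).
  apply: (@computable_oracle _ (fun p => encode (search_from c p))).
  exact: computable_encode_search_from.
have cq' : computable_in halting_set (fun p => q' p).
  apply: (@computable_oracle _ (fun p => encode (search_from c' p))).
  exact: computable_encode_search_from.
have [|x|y cy yP] := @computable_search halting_set (fun p => q p && q' p).
- by computability.
- have [Ax|] := EM (A x).
    move: (Ax); rewrite AR => -[y Ry]; exists y.
    by have /negbTE-> : ~~ q (npair x y) by apply/negP => /qP[z nR]; apply: nR.
  rewrite {1}AR' => nA.
  have [y ny] : exists y, ~ exists z, R' (npair x (npair y z)).
    by apply/existsNP.
  exists y; have /negbTE-> : ~~ q' (npair x y) by apply/negP => /qP'.
  by rewrite andbF.
apply: (@eq_computable _ (fun x => ~~ q (npair x (y x)))); last first.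
  by apply: computable_negb; apply: (computable_comp cq); computability.
move=> x; congr nat_of_bool; have := yP x.
have [qx /= nq'|nq _] := boolP (q (npair x (y x))) => /=.
  apply/esym/negbTE/negP; rewrite in_setE AR' => /(_ (y x))/qP'.
  by move=> q'x; rewrite q'x in nq'.
apply/esym/mem_set; rewrite AR; exists (y x) => z.
by apply: contrapT => nR; case/negP: nq; apply/qP; exists z.
Qed.

(** * Strings as numbers *)

(** If [s] is the code of a string then [query s i] is 0 when the string has no
    entry [i], and one more than this entry otherwise.  In bijective base-2
    numeration, halving the predecessor of a nonzero code drops the first entry
    of the string, which is 1 exactly when the code is even. *)
Definition query (s i : nat) : nat :=
  let m := iter i (fun n => n.-1./2) s in if 0 < m then (~~ odd m).+1 else 0.

Definition agrees (s : nat) (X : set nat) (m : nat) : Prop :=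
  forall i, i < m -> query s i = (i \in X).+1.

Definition compatible (s : nat) (X : set nat) : Prop :=
  forall i, query s i = 0 \/ query s i = (i \in X).+1.

Lemma computable_query X f g : computable_in X f -> computable_in X g ->
  computable_in X (fun x => query (f x) (g x)).
Proof.
move=> cf cg; rewrite /query.
have ci : computable_in X (fun x => iter (g x) (fun n => n.-1./2) (f x)).
  by computability.
by computability.
Qed.
#[local] Hint Resolve computable_query : computable.

Lemma query_string_code s i :
  query (string_code s) i = if i < size s then (nth false s i).+1 else 0.
Proof.
rewrite /query; elim: s i => [|b s IHs] i.
  by rewrite (_ : iter i _ _ = 0) //; elim: i => //= i ->.
case: i => [|i]; first by rewrite /= addnS /= oddD odd_double oddb negbK.
rewrite iterSr -IHs (_ : (string_code _).-1./2 = string_code s) //.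
by rewrite /= addnS /= addnC half_bit_double.
Qed.

Lemma string_code_surj n : exists s, string_code s = n.
Proof.
elim/ltn_ind: n => -[|n] IHn; first by exists [::].
have [|s es] := IHn n./2; first by rewrite ltnS -divn2 leq_div.
exists (odd n :: s); rewrite /= es addnS addnC.
by rewrite odd_double_half.
Qed.

(** The codes of the extensions of a given string form an arithmetic progression
    indexed by all numbers, so a search for an extension is a search for a
    number. *)
Lemma string_code_cat s t :
  string_code (s ++ t) = string_code s + 2 ^ size s * string_code t.
Proof.
elim: s => [|b s IHs] /=; first by rewrite mul1n.
by rewrite IHs doubleD expnS -mulnA mul2n addnAC.
Qed.

Lemma computable_restrict X L : computable_in X (fun i => i \in L) ->
  computable_in X (fun k => string_code (restrict L k)).
Proof.
move=> cL; apply: (@eq_computable _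
  (fun k => iteri k (fun i s => s + 2 ^ i * (i \in L).+1) 0)).
  elim=> // k IHk; rewrite [LHS]/= IHk /restrict mkseqS -cats1 string_code_cat.
  by rewrite size_mkseq /= double0 add0n.
by computability.
Qed.

Lemma query_restrict L k i :
  query (string_code (restrict L k)) i = if i < k then (i \in L).+1 else 0.
Proof.
by rewrite query_string_code size_mkseq; case: ifP => // ik; rewrite nth_mkseq.
Qed.

(** * Bounded evaluation *)

Definition guard (v w : nat) : nat := if 0 < v then w else 0.

(** The states of a bounded search for a zero: 1 while it goes on, [y.+2] once [y]
    is found, and 0 after an undefined value.  The arguments are the position
    [i], the state [h] and the value [v] at [i], which is 0 when undefined and
    otherwise one more than the actual value; hence [v == 1] at a zero. *)
Definition find_step (i h v : nat) : nat :=
  if h == 1 then if v == 0 then 0 else if v == 1 then i.+2 else 1 else h.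

(** Evaluation with the string of code [s] as oracle, in which every search is
    cut after [b] steps.  The result 0 means that no value was found, and
    [y.+1] stands for the value [y]. *)
Fixpoint bounded_eval (s b : nat) (c : code) : nat -> nat :=
  match c with
  | Zero => fun=> 1
  | Succ => fun x => x.+2
  | Fst => fun x => (nfst x).+1
  | Snd => fun x => (nsnd x).+1
  | Oracle => fun x => query s x
  | Pair f g => fun x =>
      let v := bounded_eval s b f x in let w := bounded_eval s b g x in
      guard v (guard w (npair v.-1 w.-1).+1)
  | Comp f g => fun x =>
      let v := bounded_eval s b g x in guard v (bounded_eval s b f v.-1)
  | Rec f g => fun x =>
      iteri (nsnd x)
        (fun n h => guard h (bounded_eval s b g (npair (nfst x) (npair n h.-1))))
        (bounded_eval s b f (nfst x))
  | Mu f => fun x =>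
      (iteri b (fun i h => find_step i h (bounded_eval s b f (npair x i))) 1).-1
  end.

Lemma find_step_sound v n :
  let h := iteri n (fun i h => find_step i h (v i)) 1 in
  (h = 1 -> forall i, i < n -> 1 < v i) /\
  (forall y, h = y.+2 -> v y = 1 /\ forall i, i < y -> 1 < v i).
Proof.
elim: n => [|n [IH1 IH2]] /=; first by split.
move: IH1 IH2; set h := iteri _ _ _ => IH1 IH2; rewrite /find_step.
have [h1|h1] := eqVneq h 1; last by split=> // h1'; rewrite h1' in h1.
have [//|v0] := eqVneq (v n) 0; have [v1|v1] := eqVneq (v n) 1; split=> //.
  by move=> y [<-]; split=> //; apply: IH1.
move=> _ i; rewrite ltnS leq_eqVlt => /predU1P[->|]; last exact: IH1.
by case: (v n) v0 v1 => [|[]].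
Qed.

Lemma find_step_complete v y n : v y = 1 -> (forall i, i < y -> 1 < v i) ->
  y < n -> iteri n (fun i h => find_step i h (v i)) 1 = y.+2.
Proof.
move=> vy vlt; elim: n => // n IHn; rewrite ltnS leq_eqVlt.
case/predU1P => [<-|/IHn /= ->] //=.
have -> : iteri y (fun i h => find_step i h (v i)) 1 = 1.
  elim: {1 3}y (leqnn y) => //= m IHm ltmy.
  by rewrite IHm ?(ltnW ltmy) // /find_step /=; case: (v m) (vlt m ltmy) => [|[]].
by rewrite /find_step vy.
Qed.

Lemma guardP v w y : guard v w = y.+1 -> exists2 u, v = u.+1 & w = y.+1.
Proof. by case: v => //= u; exists u. Qed.

Lemma bounded_eval_sound X s b c x y :
  compatible s X -> bounded_eval s b c x = y.+1 -> eval X c x y.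
Proof.
move=> sX; elim: c x y => [|||||f IHf g IHg|f IHf g IHg|f IHf g IHg|f IHf] x y /=;
  try by case.
- by case: (sX x) => -> // [<-].
- case/guardP => u fu /guardP[w gw]; rewrite fu gw => -[<-].
  by exists u, w; split; [apply: IHf|apply: IHg|].
- case/guardP => u gu; rewrite gu => fu.
  by exists u; [apply: IHg|apply: IHf].
- elim: (nsnd x) y => [|n IHn] y /=; first exact: IHf.
  case/guardP => u hu; rewrite hu => gu.
  by exists u; [apply: IHn|apply: IHg].
- have /= [_] := find_step_sound (fun i => bounded_eval s b f (npair x i)) b.
  case: (iteri _ _ _) => [|[|h]] // /(_ h erefl)[fh flt] [<-].
  split; first exact: IHf.
  move=> i /flt; case e: (bounded_eval _ _ _ _) => [|[|v]] // _.
  by exists v; apply: IHf.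
Qed.

(** A converging computation only looks at finitely much of the oracle and only
    makes finitely many searches, each of which ends. *)
Lemma bounded_eval_complete X c x y : eval X c x y ->
  exists m, forall s b, m <= b -> agrees s X m -> bounded_eval s b c x = y.+1.
Proof.
have agreesW m n s : m <= n -> agrees s X n -> agrees s X m.
  by move=> mn sX i /leq_trans/(_ mn)/sX.
elim: c x y => [|||||f IHf g IHg|f IHf g IHg|f IHf g IHg|f IHf] x y /=;
  try by move=> ->; exists 0.
- by move=> ->; exists x.+1 => s b _; apply.
- move=> [u [w [/IHf[m fm] /IHg[n gn] ->]]]; exists (maxn m n) => s b.
  rewrite geq_max => /andP[mb nb] sX.
  by rewrite fm ?gn //; apply: agreesW sX; rewrite (leq_maxl, leq_maxr).
- move=> [u /IHg[n gn] /IHf[m fm]]; exists (maxn m n) => s b.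
  rewrite geq_max => /andP[mb nb] sX.
  by rewrite gn /= ?fm //; apply: agreesW sX; rewrite (leq_maxl, leq_maxr).
- elim: (nsnd x) y => [|k IHk] y /=; first exact: IHf.
  move=> [u /IHk[n hn] /IHg[m gm]]; exists (maxn m n) => s b.
  rewrite geq_max => /andP[mb nb] sX.
  by rewrite hn /= ?gm //; apply: agreesW sX; rewrite (leq_maxl, leq_maxr).
move=> [/IHf[m0 f0] flt].
have [m fm] : exists m, forall s b, m <= b -> agrees s X m ->
    forall i, i < y -> 1 < bounded_eval s b f (npair x i).
  elim: y flt {f0} => [|y IHy] flt; first by exists 0.
  have [i iy|m fm] := IHy; first by apply: flt; apply: ltnW.
  have [v /IHf[n fn]] := flt y (ltnSn y); exists (maxn m n) => s b.
  rewrite geq_max => /andP[mb nb] sX i; rewrite ltnS leq_eqVlt.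
  case/predU1P => [->|].
    by rewrite fn //; apply: agreesW sX; rewrite leq_maxr.
  by apply: fm => //; apply: agreesW sX; rewrite leq_maxl.
exists (maxn y.+1 (maxn m0 m)) => s b; rewrite !geq_max => /and3P[yb m0b mb] sX.
rewrite (@find_step_complete (fun i => bounded_eval s b f (npair x i)) y) //.
  by rewrite f0 //; apply: agreesW sX; rewrite leq_max leq_max leqnn !orbT.
apply: fm => //.
by apply: agreesW sX; rewrite leq_max leq_max leqnn !orbT.
Qed.

(** * Bounded evaluation as a code *)

(** The codes below handle the inputs of the clauses of [bounded].  The code
    [bounded c] reads <a, x>, where a = <s, b> consists of an oracle string and
    a bound.  For [Rec f g], <a, <u, n>> is turned into <<a, u>, n>, and the
    recursion step reads <<a, u>, <i, h>>; for [Mu f], it is turned into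
    <<a, x>, b>, and the step reads <<a, x>, <i, h>>. *)
Definition join_code := code_of (fun z =>
  guard (nfst z) (guard (nsnd z) (npair (nfst z).-1 (nsnd z).-1).+1)).
Definition guard_code := code_of (fun z => guard (nfst z) (nsnd z)).
Definition pred_code := code_of predn.
Definition rec_input_code := code_of (fun z =>
  npair (npair (nfst z) (nfst (nsnd z))) (nsnd (nsnd z))).
Definition rec_value_code := code_of (fun z => nsnd (nsnd z)).
Definition rec_step_code := code_of (fun z =>
  npair (nfst (nfst z)) (npair (nsnd (nfst z))
    (npair (nfst (nsnd z)) (nsnd (nsnd z)).-1))).
Definition mu_input_code := code_of (fun z => npair z (nsnd (nfst z))).
Definition mu_start_code := code_of (fun=> 1).
Definition mu_test_code := code_of (fun z =>
  npair (nfst (nfst z)) (npair (nsnd (nfst z)) (nfst (nsnd z)))).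
Definition mu_step_code := code_of (fun z =>
  find_step (nfst (nfst z)) (nsnd (nfst z)) (nsnd z)).

(** The clauses follow those of [bounded_eval].  A part may be run here on the
    predecessor of an undefined value; as these codes always converge, this does
    no harm, and the result is then discarded by [guard]. *)
Fixpoint bounded (c : code) : code :=
  match c with
  | Zero => code_of (fun=> 1)
  | Succ => code_of (fun z => (nsnd z).+2)
  | Fst => code_of (fun z => (nfst (nsnd z)).+1)
  | Snd => code_of (fun z => (nsnd (nsnd z)).+1)
  | Oracle => code_of (fun z => query (nfst (nfst z)) (nsnd z))
  | Pair f g => Comp join_code (Pair (bounded f) (bounded g))
  | Comp f g =>
      Comp guard_code (Pair (bounded g)
        (Comp (bounded f) (Pair Fst (Comp pred_code (bounded g)))))
  | Rec f g =>
      Comp (Rec (bounded f) (Comp guard_code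
             (Pair rec_value_code (Comp (bounded g) rec_step_code))))
        rec_input_code
  | Mu f =>
      Comp pred_code (Comp
        (Rec mu_start_code
           (Comp mu_step_code (Pair Snd (Comp (bounded f) mu_test_code))))
        mu_input_code)
  end.

Lemma computable_guard X f g : computable_in X f -> computable_in X g ->
  computable_in X (fun x => guard (f x) (g x)).
Proof. by move=> cf cg; rewrite /guard; computability. Qed.
#[local] Hint Resolve computable_guard : computable.

Lemma computable_find_step X f g h :
  computable_in X f -> computable_in X g -> computable_in X h ->
  computable_in X (fun x => find_step (f x) (g x) (h x)).
Proof. by move=> cf cg ch; rewrite /find_step; computability. Qed.
#[local] Hint Resolve computable_find_step : computable.

Lemma eval_code_of f x y :
  computable_in set0 f -> f x = y -> eval set0 (code_of f) x y.
Proof. by move=> cf <-; apply: code_ofP. Qed.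

Lemma eval_bounded s b c x :
  eval set0 (bounded c) (npair (npair s b) x) (bounded_eval s b c x).
Proof.
have ev f z y : computable_in set0 f -> f z = y -> eval set0 (code_of f) z y.
  exact: eval_code_of.
elim: c x => [|||||f IHf g IHg|f IHf g IHg|f IHf g IHg|f IHf] x.
1-5: by apply: ev; [computability|rewrite /= ?npairE].
- apply: eval_Comp (eval_Pair (IHf x) (IHg x)) _.
  by apply: ev; [computability|rewrite /= !npairE].
- apply: (@eval_Comp _ _ _ _ (npair (bounded_eval s b g x)
    (bounded_eval s b f (bounded_eval s b g x).-1))); last first.
    by apply: ev; [computability|rewrite /= !npairE].
  apply: eval_Pair; first exact: IHg.
  apply: eval_Comp (IHf _); apply: eval_Pair; first by rewrite /= npairE.
  by apply: eval_Comp (IHg x) _; apply: ev; first by computability.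
- apply: (@eval_Comp _ _ _ _ (npair (npair (npair s b) (nfst x)) (nsnd x))).
    by apply: ev; [computability|rewrite /= !npairE].
  apply: eval_Rec => [|i h]; first exact: IHf.
  apply: (@eval_Comp _ _ _ _
    (npair h (bounded_eval s b g (npair (nfst x) (npair i h.-1))))); last first.
    by apply: ev; [computability|rewrite /= !npairE].
  apply: eval_Pair; first by apply: ev; [computability|rewrite /= !npairE].
  apply: eval_Comp (IHg _); apply: ev; first by computability.
  by rewrite /= !npairE.
- apply: (@eval_Comp _ _ _ _ (iteri b (fun i h =>
    find_step i h (bounded_eval s b f (npair x i))) 1)); last first.
    by apply: ev; first by computability.
  apply: (@eval_Comp _ _ _ _ (npair (npair (npair s b) x) b)).
    by apply: ev; [computability|rewrite /= !npairE].
  apply: eval_Rec => [|i h]; first by apply: ev; first by computability.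
  apply: (@eval_Comp _ _ _ _
    (npair (npair i h) (bounded_eval s b f (npair x i)))); last first.
    by apply: ev; [computability|rewrite /= !npairE].
  apply: eval_Pair; first by rewrite /= !npairE.
  apply: eval_Comp (IHf _); apply: ev; first by computability.
  by rewrite /= !npairE.
Qed.

(** The translation of a compound code is put together from the translations of
    its parts, whose Goedel numbers are smaller. *)
Lemma computable_encode_bounded X :
  exists2 t, computable_in X t & forall c, t (encode c) = encode (bounded c).
Proof.
have [dec decK encK] := encode_bij.
exists (fun n => encode (bounded (dec n))); last by move=> c; rewrite decK.
pose G n h :=
  let q := (n - 5) %/ 4 in let r := (n - 5) %% 4 in
  let tf := recall n h (nfst q) in let tg := recall n h (nsnd q) in
  let t := recall n h q in
  if n == 0 then encode (bounded Zero) else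
  if n == 1 then encode (bounded Succ) else
  if n == 2 then encode (bounded Fst) else
  if n == 3 then encode (bounded Snd) else
  if n == 4 then encode (bounded Oracle) else
  if r == 0 then eComp (encode join_code) (ePair tf tg) else
  if r == 1 then eComp (encode guard_code)
    (ePair tg (eComp tf (ePair (encode Fst) (eComp (encode pred_code) tg)))) else
  if r == 2 then
    eComp (eRec tf (eComp (encode guard_code)
            (ePair (encode rec_value_code) (eComp tg (encode rec_step_code)))))
      (encode rec_input_code) else
  eComp (encode pred_code) (eComp
    (eRec (encode mu_start_code) (eComp (encode mu_step_code)
       (ePair (encode Snd) (eComp t (encode mu_test_code)))))
    (encode mu_input_code)).
apply: (@computable_course_of_values _ _ G).
  by rewrite /G; computability.
move=> n; rewrite -(encK n); move: (dec n) => c; rewrite decK.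
(* A compound code is numbered 5 + (r + 4 * m), where [r] is its kind. *)
have divE r m : r < 4 -> (5 + (r + 4 * m) - 5) %/ 4 = m.
  by move=> r4; rewrite addKn mulnC addnC divnMDl // divn_small ?addn0.
have modE r m : r < 4 -> (5 + (r + 4 * m) - 5) %% 4 = r.
  by move=> r4; rewrite addKn mulnC addnC modnMDl modn_small.
have lt r m : m < 5 + (r + 4 * m).
  apply: (@leq_ltn_trans (4 * m)); first by rewrite leq_pmull.
  by rewrite addnA -[X in X < _]add0n ltn_add2r.
have lt1 r a b : a < 5 + (r + 4 * npair a b).
  apply: leq_ltn_trans (lt r _).
  by have := proj1 (npair_ge (npair a b)); rewrite npairE.
have lt2 r a b : b < 5 + (r + 4 * npair a b).
  apply: leq_ltn_trans (lt r _).
  by have := proj2 (npair_ge (npair a b)); rewrite npairE.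
case: c => [|||||f g|f g|f g|f] //.
- rewrite /G (_ : encode (Pair f g) =
    5 + (0 + 4 * npair (encode f) (encode g))) //; cbv zeta.
  by rewrite divE ?modE // !npairE !recallE // !decK.
- rewrite /G (_ : encode (Comp f g) =
    5 + (1 + 4 * npair (encode f) (encode g))) //; cbv zeta.
  by rewrite divE ?modE // !npairE !recallE // !decK.
- rewrite /G (_ : encode (Rec f g) =
    5 + (2 + 4 * npair (encode f) (encode g))) //; cbv zeta.
  by rewrite divE ?modE // !npairE !recallE // !decK.
- rewrite /G; cbv zeta; rewrite (_ : encode (Mu f) = 5 + (3 + 4 * encode f)) //.
  by rewrite divE // modE // (recallE _ (lt 3 (encode f))) !decK.
Qed.

(** * Splittings and the amalgamated function *)

(** Strings are given here by the pair of their length and their code, so that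
    [extend p r] is the code of the extension by the string of code [r]. *)
Definition position (L : set nat) (k : nat) : nat :=
  npair k (string_code (restrict L k)).

Definition extend (p r : nat) : nat := nsnd p + 2 ^ nfst p * r.

(** The number [w] is read as <r, b>: the extension of [p] by the string of code
    [r] is tried as oracle with bound [b]. *)
Definition trial (p x w : nat) : nat :=
  npair (npair (extend p (nfst w)) (nsnd w)) x.

Definition run (c : code) (p x w : nat) : nat :=
  bounded_eval (extend p (nfst w)) (nsnd w) c x.

Lemma extend_position L k t :
  extend (position L k) (string_code t) = string_code (restrict L k ++ t).
Proof. by rewrite /extend /position !npairE string_code_cat size_mkseq. Qed.

Lemma extend_position_restrict L k m : k <= m ->
  exists r, extend (position L k) r = string_code (restrict L m).
Proof.
move=> km; exists (string_code (drop k (restrict L m))).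
rewrite extend_position -[in RHS](cat_take_drop k (restrict L m)).
by rewrite {2}/restrict /mkseq -map_take take_iota (minn_idPl km).
Qed.

Lemma eval_run c p x w : eval set0 (bounded c) (trial p x w) (run c p x w).
Proof. exact: eval_bounded. Qed.

Lemma computable_extend X f g : computable_in X f -> computable_in X g ->
  computable_in X (fun x => extend (f x) (g x)).
Proof. by move=> cf cg; rewrite /extend; computability. Qed.
#[local] Hint Resolve computable_extend : computable.

Lemma computable_trial X f g h :
  computable_in X f -> computable_in X g -> computable_in X h ->
  computable_in X (fun x => trial (f x) (g x) (h x)).
Proof. by move=> cf cg ch; rewrite /trial; computability. Qed.
#[local] Hint Resolve computable_trial : computable.

(** Here w = <x, <w1, w2>>: the trials [w1] and [w2] give two values at [x]. *)
Definition splits (c : code) (p w : nat) : bool :=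
  let v1 := run c p (nfst w) (nfst (nsnd w)) in
  let v2 := run c p (nfst w) (nsnd (nsnd w)) in
  [&& 0 < v1, 0 < v2 & v1 != v2].

Definition compare_code :=
  code_of (fun v => ~~ [&& 0 < nfst v, 0 < nsnd v & nfst v != nsnd v]).
Definition left_code :=
  code_of (fun z => trial (nfst z) (nfst (nsnd z)) (nfst (nsnd (nsnd z)))).
Definition right_code :=
  code_of (fun z => trial (nfst z) (nfst (nsnd z)) (nsnd (nsnd (nsnd z)))).

Definition splits_code (c : code) : code :=
  Comp compare_code
    (Pair (Comp (bounded c) left_code) (Comp (bounded c) right_code)).

Lemma eval_splits_code c z :
  eval set0 (splits_code c) z (~~ splits c (nfst z) (nsnd z)).
Proof.
pose v1 := run c (nfst z) (nfst (nsnd z)) (nfst (nsnd (nsnd z))).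
pose v2 := run c (nfst z) (nfst (nsnd z)) (nsnd (nsnd (nsnd z))).
apply: (@eval_Comp _ _ _ _ (npair v1 v2)); last first.
  by apply: eval_code_of; [computability|rewrite !npairE].
by apply: eval_Pair; apply: eval_Comp (eval_run _ _ _ _);
  apply: code_ofP; computability.
Qed.

Lemma halting_splits c p :
  (encode (search_from (splits_code c) p) \in halting_set) <->
  exists w, splits c p w.
Proof.
rewrite (halting_search_from _ (eval_splits_code c)).
split=> -[w]; rewrite ?npairE => sw; exists w; rewrite ?npairE;
  last by rewrite sw.
by case: (splits _ _ _) sw.
Qed.

Definition id_code := code_of id.
Definition branch_code :=
  code_of (fun z => trial (nfst (nfst z)) (nsnd (nfst z)) (nsnd z)).
Definition undefined_code := code_of (fun v => v == 0).

(** On input [x], this code takes the first trial above [p] that yields a value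
    at [x]: it forms <p, x>, adds the trial found by [Mu], and evaluates. *)
Definition amalgam (c : code) (p : nat) : code :=
  Comp (Comp pred_code (Comp (bounded c) branch_code))
    (Comp
      (Pair id_code (Mu (Comp undefined_code (Comp (bounded c) branch_code))))
      (Pair (const_code p) id_code)).

Lemma eval_amalgam c p x : (exists w, 0 < run c p x w) ->
  exists2 w, 0 < run c p x w & eval set0 (amalgam c p) x (run c p x w).-1.
Proof.
move=> [w0 cw0].
have cbranch z : eval set0 (Comp (bounded c) branch_code) z
    (run c (nfst (nfst z)) (nsnd (nfst z)) (nsnd z)).
  by apply: eval_Comp (eval_run _ _ _ _); apply: code_ofP; computability.
have cid z : eval set0 id_code z z by apply: (@code_ofP id); apply: computable_id.
have cundef z : eval set0 (Comp undefined_code (Comp (bounded c) branch_code)) z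
    (run c (nfst (nfst z)) (nsnd (nfst z)) (nsnd z) == 0).
  apply: eval_Comp (cbranch z) _.
  by apply: (@code_ofP (fun v => v == 0)); computability.
have [|w muw] := @eval_Mu _ _ _ (npair p x) cundef.
  by exists w0; rewrite !npairE; case: (run _ _ _ _) cw0.
rewrite !npairE => cw; exists w; first by case: (run _ _ _ _) cw.
apply: (@eval_Comp _ _ _ _ (npair (npair p x) w)).
  apply: (@eval_Comp _ _ _ _ (npair p x)); last exact: eval_Pair.
  by apply: eval_Pair => //; apply: eval_const_code.
apply: (@eval_Comp _ _ _ _ (run c p x w)).
  by have := cbranch (npair (npair p x) w); rewrite !npairE.
by apply: (@code_ofP predn); computability.
Qed.

Lemma computable_encode_search_splits X : exists2 s, computable_in X s &
  forall c p, s (npair (encode c) p) = encode (search_from (splits_code c) p).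
Proof.
have [t ct tE] := computable_encode_bounded X.
exists (fun z => eComp (eMu (eComp (encode compare_code)
    (ePair (eComp (t (nfst z)) (encode left_code))
           (eComp (t (nfst z)) (encode right_code)))))
  (encode (const_code (nsnd z)))); first by computability.
by move=> c p; rewrite !npairE tE.
Qed.

Lemma computable_encode_amalgam X : exists2 j, computable_in X j &
  forall c p, j (npair (encode c) p) = encode (amalgam c p).
Proof.
have [t ct tE] := computable_encode_bounded X.
exists (fun z =>
  let b := eComp (t (nfst z)) (encode branch_code) in
  eComp (eComp (encode pred_code) b)
    (eComp (ePair (encode id_code) (eMu (eComp (encode undefined_code) b)))
      (ePair (encode (const_code (nsnd z))) (encode id_code)))); last first.
  by move=> c p; rewrite !npairE tE.
by cbv zeta; computability.
Qed.

(** * Generic oracles that compute a computable function *)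

(** Genericity is applied to the set of strings along which [c] yields a value
    that differs from [f].  The alternative that an initial segment of [L] is
    in it contradicts [Lf]. *)
Lemma generic_decides L c f : one_generic L -> computable_in set0 f ->
  (forall x, eval L c x (f x)) ->
  exists k, forall x w, run c (position L k) x w = 0 \/
    run c (position L k) x w = (f x).+1.
Proof.
move=> genL cf Lf.
pose wrong n w := let v := bounded_eval n (nsnd w) c (nfst w) in
  (0 < v) && (v != (f (nfst w)).+1).
pose S := [set s | exists w, wrong (string_code s) w].
have [d dP] : computable_in set0 (fun z => ~~ wrong (nfst z) (nsnd z)).
  have cv : computable_in set0
     (fun z => bounded_eval (nfst z) (nsnd (nsnd z)) c (nfst (nsnd z))).
    exists (Comp (bounded c) (code_of (fun z =>
      npair (npair (nfst z) (nsnd (nsnd z))) (nfst (nsnd z))))) => z.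
    by apply: eval_Comp (eval_bounded _ _ _ _); apply: code_ofP; computability.
  by rewrite /wrong; cbv zeta; computability.
have muP n : (exists w, wrong n w) <-> exists y, eval set0 (Mu d) n y.
  split=> [[w nw]|[y [dy _]]].
    have [|y muy _] := @eval_Mu _ _ _ n dP; last by exists y.
    by exists w; rewrite !npairE nw.
  exists y; have := eval_functional (dP _) dy; rewrite !npairE.
  by case: (wrong _ _).
have [|k] := genL S.
  exists (encode (Mu d)); apply/seteqP; split=> n.
    by move=> [s /muP[y muy] <-]; exists y, (Mu d).
  move=> [y [d' /(bij_inj encode_bij)-> muy]]; have [s sn] := string_code_surj n.
  by exists s => //; apply/muP; rewrite sn; exists y.
case=> [[w /andP[]]|noS].
  case e: (bounded_eval _ _ _ _) => [//|y] _ /eqP[]; congr _.+1.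
  apply: eval_functional (Lf _); apply: bounded_eval_sound e => i.
  by rewrite query_restrict; case: ifP; [right|left].
exists k => x w; have [t et] := string_code_surj (nfst w).
have [|] := eqVneq (run c (position L k) x w) 0; [by left|right].
apply/eqP; apply/negP => ne; apply: (noS (restrict L k ++ t)).
  exact: prefix_prefix.
exists (npair x (nsnd w)).
rewrite /wrong !npairE -extend_position et lt0n.
by apply/andP; split; last apply/negP.
Qed.

(** The trial uses an initial segment of [L] that is longer than [k] and than the
    part of the oracle inspected by the computation. *)
Lemma run_position L c x y k : eval L c x y ->
  exists w, run c (position L k) x w = y.+1.
Proof.
move=> /bounded_eval_complete[m mP].
have [r er] := extend_position_restrict L (leq_maxl k m).
exists (npair r m); rewrite /run !npairE er mP // => i im.
by rewrite query_restrict leq_max im orbT.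
Qed.

Theorem theorem3p4 (L : set nat) :
  delta02 L -> one_generic L -> index_guessable L.
Proof.
move=> /delta02_computable cL genL.
have [s cs sE] := computable_encode_search_splits halting_set.
have [j [cj cjP] jE] := computable_encode_amalgam halting_set.
have [q cq qE] : exists2 q, computable_in halting_set q &
    forall e k, q (npair e k) = npair e (position L k).
  exists (fun z => npair (nfst z) (position L (nsnd z))).
    rewrite /position; have := computable_restrict cL => cr.
    by computability.
  by move=> e k; rewrite !npairE.
have [q' cq'] := cq.
have [N NP] : computable_in halting_set (fun z => s (q z) \in halting_set).
  by computability.
exists (encode (Comp cj (Comp q' (Pair (Pair Fst Snd) (Mu N))))).
move=> e [tot [i eqi]].
have [c ec] : exists c, encode c = e by have [y [c ec _]] := tot 0; exists c.
have [f fP] := choice tot.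
have Lf x : eval L c x (f x).
  by have [c'] := fP x; rewrite -ec => /(bij_inj encode_bij)->.
have cf : computable_in set0 f.
  have [d ed] : exists d, encode d = i.
    by have := fP 0; rewrite eqi => -[d ed _]; exists d.
  exists d => x; have := fP x; rewrite eqi => -[d'].
  by rewrite -ed => /(bij_inj encode_bij)->.
have sq k : s (q (npair e k)) =
    encode (search_from (splits_code c) (position L k)).
  by rewrite qE -ec sE.
(* The search for a position without splittings ends. *)
have [|k muk] := @eval_Mu _ _ _ e NP.
  have [k kP] := generic_decides genL cf Lf; exists k; rewrite sq.
  case: (boolP (_ \in _)) => // /halting_splits[w /and3P[]].
  move: (kP (nfst w) (nfst (nsnd w))) (kP (nfst w) (nsnd (nsnd w))).
  by move=> [->//|->] [->//|->] _ _; rewrite eqxx.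
rewrite sq => nosplit.
(* Any value found above this position is that of the run along [L]. *)
have amP x : eval set0 (amalgam c (position L k)) x (f x).
  have [w0 w0P] := run_position k (Lf x).
  have [|w w_gt0] := @eval_amalgam c (position L k) x.
    by exists w0; rewrite w0P.
  suff -> : run c (position L k) x w = (f x).+1 by [].
  apply/eqP/negPn/negP => ne.
  suff : exists v, splits c (position L k) v.
    by move=> /halting_splits; case: (_ \in _) nosplit.
  by exists (npair x (npair w w0)); rewrite /splits !npairE w0P w_gt0 ne.
exists (encode (amalgam c (position L k))).
  eexists; first by reflexivity.
  apply: (@eval_Comp _ _ _ _ (npair e (position L k))).
    apply: (@eval_Comp _ _ _ _ (npair e k)); last by rewrite -qE.
    apply: eval_Pair => //; rewrite -[X in eval _ _ _ X]nfst_nsndK.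
    exact: eval_Pair.
  by rewrite -jE ec.
apply/funext => x; apply/funext => y; apply/propext; split.
  move=> /(Phi_functional (fP x))<-; by exists (amalgam c (position L k)).
move=> phy; suff -> : y = f x by exact: fP.
apply: (Phi_functional phy); by exists (amalgam c (position L k)).
Qed.
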